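(* Let $G$ be a compactly generated locally compact group. Assume that every lattice in $G$ has a trivial centralizer in $G$. Let $\mathcal F$ be a family of lattices in $G$ with property $(KM)$ and admitting some $\Gamma\in\mathcal F$ that is finitely generated and is a least element of $\mathcal F$ with respect to inclusion. Then $\mathcal F$ is finite.
   Context: A lattice in a locally compact group $G$ is a discrete subgroup of finite co-volume. A family $\mathcal F$ of lattices in $G$ has property $(KM)$ if there is an identity neighborhood $U\subset G$ such that for every lattice $\Gamma\in\mathcal F$ there is an element $g\in G$ satisfying $g\Gamma g^{-1}\cap U=\{e\}$. Least element means that $\Gamma\le\Gamma'$ for every $\Gamma'\in\mathcal F$. *)

(* Defs.v *)
From HB Require Import structures.
From mathcomp Require Import all_boot all_order all_algebra.
From mathcomp Require Import all_classical all_reals all_analysis.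

Set Implicit Arguments.
Unset Strict Implicit.
Unset Printing Implicit Defensive.

Local Open Scope classical_set_scope.
Local Open Scope ring_scope.
Local Open Scope group_scope.

(* The distinguished point plays no role: it is there because the measurable
   types of MathComp-Analysis, hence Borel measures on G, require one. *)
HB.mixin Record isTopologicalGroup G & PointedTopological G & Group G := {
  mulg_continuous : continuous (fun z : G * G => z.1 * z.2 : G);
  invg_continuous : continuous (fun x : G => x^-1 : G)
}.

#[short(type="topologicalGroupType")]
HB.structure Definition TopologicalGroup :=
  {G of isTopologicalGroup G & PointedTopological G & Group G}.

Section Subgroups.
Variable G : topologicalGroupType.
Implicit Types (H K U S : set G) (F : set (set G)).

Definition subgroup H : Prop :=
  [/\ H 1, forall x y, H x -> H y -> H (x * y) & forall x, H x -> H x^-1].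

Definition generated S : set G := smallest subgroup S.

Definition finitely_generated H : Prop :=
  exists2 S : set G, finite_set S & generated S = H.

Definition compactly_generated : Prop :=
  exists2 K : set G, compact K & generated K = [set: G].

Definition conjugate (g : G) H : set G := [set g * x * g^-1 | x in H].

Definition centralizer H : set G :=
  [set g | forall x, H x -> g * x = x * g].

Definition discrete_subgroup H : Prop :=
  subgroup H /\ H `<=` isolated H.

(* Locally compact groups are Hausdorff by convention. *)
Definition locally_compact_group : Prop :=
  hausdorff_space G /\ locally_compact [set: G].

Let borel := g_sigma_algebraType (@open G).

Definition is_haar_measure (R : realType)
    (mu : {measure set borel -> \bar R}) : Prop :=
  [/\ mu [set: borel] != 0%E,
      forall K, compact K -> (mu K < +oo)%E,
      forall (g : G) (A : set borel), measurable A ->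
        mu [set g * x | x in (A : set G)] = mu A,
      forall A : set borel, measurable A ->
        mu A = ereal_inf [set mu O | O in [set O : set G | open O /\ A `<=` O]] &
      forall O : set G, open O ->
        mu O = ereal_sup [set mu K | K in [set K : set G | compact K /\ K `<=` O]]].

(* A Borel set of representatives of the cosets H x, i.e. of the orbits of H
   acting on G by left multiplication. *)
Definition is_fundamental_domain H (D : set borel) : Prop :=
  measurable D /\
  forall x : G, exists! y : G, D y /\ exists2 h, H h & y = h * x.

(* The co-volume of H is the Haar measure of a fundamental domain.  Haar
   measure is left-invariant and H acts on the left, so for countable H (every
   discrete subgroup of a sigma-compact G) this does not depend on the domain;
   finiteness does not depend on the choice of mu either, by uniqueness of Haar
   measure up to scaling. *)
Definition finite_covolume (R : realType) H : Prop :=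
  exists (mu : {measure set borel -> \bar R}) (D : set borel),
    [/\ is_haar_measure mu, is_fundamental_domain H D & (mu D < +oo)%E].

Definition lattice (R : realType) H : Prop :=
  discrete_subgroup H /\ finite_covolume R H.

Definition propertyKM F : Prop :=
  exists2 U : set G, nbhs (1 : G) U &
    forall H, F H -> exists g : G, conjugate g H `&` U = [set 1].

Definition least_element F H : Prop :=
  F H /\ forall H', F H' -> H `<=` H'.

End Subgroups.

Arguments compactly_generated : clear implicits.
Arguments locally_compact_group : clear implicits.

(* Main.v *)
Require Import Defs.
From mathcomp Require Import all_boot all_order all_algebra.
From mathcomp Require Import finmap.
From mathcomp Require Import all_classical all_reals all_analysis.

(** Let [H] be the least element of the family.  Covolumes are bounded below on
    the family by property (KM) and are multiplicative under finite index, so the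
    index of [H] in the members [K] of the family is at most some [m] that does
    not depend on [K] (lemma [index_le_covolume]).

    Let [N] be the core of [H] in [K], the kernel of the action of [K] on the
    cosets of [H].  It is also the kernel of the restriction of this action to
    [H], that is, of an action of a finitely generated group on at most [m]
    points.  There are finitely many such actions, so only finitely many groups
    [N] occur when [K] varies (lemma [eq_core]).

    Fix one of them.  It has finite index in [H], so it is again a lattice, it is
    finitely generated by Schreier's lemma, and its centralizer is trivial by
    assumption.  An element of its normalizer [L] that is close to 1 must commute
    with the generators of [N], hence is trivial: [L] is discrete (lemma
    [normalizer_discrete]).  A discrete group containing a lattice contains it
    with finite index, again by [index_le_covolume].  So there are finitely many
    groups between [N] and [L], and every [K] with core [N] is one of them. *)

Local Open Scope classical_set_scope.
Local Open Scope group_scope.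

Section Lattices_in_topological_groups.
Import Order.TTheory GRing.Theory Num.Theory.
Local Open Scope ring_scope.
Local Open Scope group_scope.
Set Implicit Arguments.
Unset Strict Implicit.
Variable G : topologicalGroupType.
Implicit Types (H K L N S U V W : set G).
Local Notation borel := (g_sigma_algebraType (@open G)).

(** * Cosets and finite index *)

Definition right_independent H n (t : 'I_n -> G) : Prop :=
  forall i j, H (t i * (t j)^-1) -> i = j.

Definition index_le H K m : Prop :=
  forall n (t : 'I_n -> G), (forall i, K (t i)) -> right_independent H t -> (n <= m)%N.

Definition right_transversal H K n (t : 'I_n -> G) : Prop :=
  [/\ forall i, K (t i), right_independent H t &
      forall x, K x -> exists i, H (x * (t i)^-1)].

Lemma subgroup_divC H x y : subgroup H -> H (x * y^-1) -> H (y * x^-1).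
Proof. by case=> _ _ HV /HV; rewrite invgM invgK. Qed.

Lemma subgroup_div H x y : subgroup H -> H x -> H y -> H (x * y^-1).
Proof. by case=> _ HM HV Hx Hy; apply: HM => //; apply: HV. Qed.

Lemma generated_subgroup S : subgroup (generated S).
Proof.
split=> [A [[]]//|x y Sx Sy A SA|x Sx A SA].
  by have [[_ AM _] _] := SA; apply: AM; [exact: Sx|exact: Sy].
by have [[_ _ AV] _] := SA; apply: AV; exact: Sx.
Qed.

Lemma sub_generated S : S `<=` generated S.
Proof. exact: sub_smallest. Qed.

Lemma generated_sub S K : subgroup K -> S `<=` K -> generated S `<=` K.
Proof. by move=> sK SK x; apply. Qed.

(** Pairwise inequivalent elements have distinct images under a map whose
    fibres lie in single cosets. *)
Lemma index_le_fiber H K (T : finType) (f : G -> T) :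
    (forall x y, K x -> K y -> f x = f y -> H (x * y^-1)) ->
  index_le H K #|T|.
Proof.
move=> Kf n t Kt indt; rewrite -[n]card_ord.
by apply: (@leq_card _ _ (f \o t)) => i j /Kf fij; apply: indt; exact: fij.
Qed.

(** A family of pairwise inequivalent elements of maximal length meets every coset. *)
Lemma exists_right_transversal H K m : subgroup H -> index_le H K m ->
  exists n (t : 'I_n -> G), (n <= m)%N /\ right_transversal H K t.
Proof.
move=> sH Hm; have [H1 _ _] := sH.
pose P n := `[< exists t : 'I_n -> G, (forall i, K (t i)) /\ right_independent H t >].
have exP : exists n, P n.
  by exists 0%N; apply/asboolP; exists (fun=> 1); split=> [[]|[]].
have Pm n : P n -> (n <= m)%N by move/asboolP => [t [/Hm]]; apply.
case: (ex_maxnP exP Pm) => n /asboolP[t [Kt indt]] maxn.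
exists n, t; split; first exact: Hm Kt indt.
split=> // x Kx; apply: contrapT => xN.
suff /maxn : P n.+1 by rewrite ltnn.
apply/asboolP; exists (fun i => oapp t x (unlift ord_max i)); split=> [i|i j].
  by case: (unlift ord_max i) => //=.
case: unliftP => [i' ->|->]; case: unliftP => [j' ->|->] //=.
- by move=> /indt ->.
- by move=> /(subgroup_divC sH) xi; case: xN; exists i'.
- by move=> xi; case: xN; exists j'.
Qed.

(** * Finitely generated groups *)

(** Schreier's lemma.  The group [P] generated by the elements
    [t i * s * (t j)^-1] of [H] has the property that the union [Q] of the
    cosets [P (t i)] is stable under right multiplication by the generators of
    [K] and their inverses, hence is all of [K]; so [P] already contains [H].
    The element [t i0] represents the coset [H] itself; it is thrown in because
    it may differ from 1. *)
Lemma finitely_generated_transversal H K n (t : 'I_n -> G) :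
    subgroup H -> H `<=` K -> finitely_generated K -> right_transversal H K t ->
  finitely_generated H.
Proof.
move=> sH HK [S finS genS] [Kt indt covt].
have sK : subgroup K by rewrite -genS; exact: generated_subgroup.
have [H1 HM HV] := sH; have [K1 KM KV] := sK.
have [i0 Hi0] := covt 1 K1; rewrite mul1g in Hi0.
have Ht0 : H (t i0) by have := HV _ Hi0; rewrite invgK.
have SK : S `<=` K by rewrite -genS; exact: sub_generated.
pose S' := S `|` [set x^-1 | x in S].
have S'K : S' `<=` K by move=> x [/SK//|[y /SK Ky <-]]; exact: KV.
have finS' : finite_set S' by rewrite finite_setU; split=> //; exact: finite_image.
pose sg (z : 'I_n * 'I_n * G) := t z.1.1 * z.2 * (t z.1.2)^-1.
pose E := t i0 |` (sg @` (setT `*` S') `&` H).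
have finE : finite_set E.
  rewrite finite_setU; split; first exact: finite_set1.
  apply/finite_setIl/finite_image/finite_setX => //.
exists E => //; apply/seteqP; split.
  by apply: generated_sub => // x [->//|[]].
set P := generated E; have [P1 PM PV] : subgroup P := generated_subgroup E.
pose Q := [set x | exists i, P (x * (t i)^-1)].
have QS x y : Q x -> S' y -> Q (x * y).
  move=> [i Pi] S'y; have [j Hj] := covt (t i * y) (KM _ _ (Kt i) (S'K _ S'y)).
  exists j; have -> : x * y * (t j)^-1 = (x * (t i)^-1) * (t i * y * (t j)^-1).
    by rewrite !mulgA mulgVK.
  apply: PM => //; apply: sub_generated; right; split=> //.
  by exists (i, j, y).
have PE0 : P (t i0) by apply: sub_generated; left.
have Q1 : Q 1 by exists i0; rewrite mul1g; exact: PV.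
(* stability under [y] and [y^-1] together makes [A] a subgroup *)
pose A := [set y | forall x, Q x -> Q (x * y) /\ Q (x * y^-1)].
have sA : subgroup A.
  split=> [x Qx|x y Ax Ay z Qz|x Ax z Qz]; first by rewrite invg1 mulg1.
    rewrite invgM !mulgA; split.
      by have [/Ay[]] := Ax _ Qz.
    by have [_ /Ax[]] := Ay _ Qz.
  by rewrite invgK; have [] := Ax _ Qz.
have KA : K `<=` A.
  rewrite -genS; apply: generated_sub => // y Sy x Qx; split; apply: QS => //.
    by left.
  by right; exists y.
move=> x Hx; have [+ _] := KA _ (HK _ Hx) _ Q1; rewrite mul1g => -[i Pi].
have Hi : H (x * (t i)^-1).
  by apply: (generated_sub sH _ Pi) => y [->//|[]].
have Hti : H (t i).
  have := HM _ _ (HV _ Hi) Hx; by rewrite invgM invgK mulgVK.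
have ii0 : i = i0 by apply: indt; apply: HM.
by have := PM _ _ Pi PE0; rewrite ii0 mulgVK.
Qed.

(** Every element is the value of a finite word in the generators and their
    inverses; the boolean of a letter records an inversion. *)
Lemma finitely_generated_countable K : finitely_generated K -> countable K.
Proof.
move=> [S /finite_seqP[s ->] <-].
pose letter (a : nat * bool) := if a.2 then (nth 1 s a.1)^-1 else nth 1 s a.1.
pose word (w : seq (nat * bool)) := foldr (fun a x => letter a * x) 1 w.
have wordM u v : word (u ++ v) = word u * word v.
  by elim: u => [|a u IH] /=; rewrite ?mul1g // IH mulgA.
have wordV u : exists v, word v = (word u)^-1.
  elim: u => [|[i b] u [v IH]] /=; first by exists [::]; rewrite /= invg1.
  exists (v ++ [:: (i, ~~ b)]); rewrite wordM IH invgM /= mulg1.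
  by congr (_ * _); case: b; rewrite /letter /= ?invgK.
have swords : subgroup (range word).
  split=> [|x y [u _ <-] [v _ <-]|x [u _ <-]]; first by exists [::].
    by exists (u ++ v).
  by have [v <-] := wordV u; exists v.
apply: (sub_countable (subset_card_le (generated_sub swords _)))=> [x xs|].
  exists [:: (index x s, false)] => //=.
  by rewrite /letter /= mulg1 nth_index.
exact: sub_countable (card_image_le _ _) (countableP _).
Qed.

(** * The core and the action on cosets *)

(** The intersection of the conjugates of [H] under [K]; when [H] has finite
    index in [K], it is a subgroup of [H] of finite index, normal in [K]. *)
Definition core H K : set G :=
  [set x | K x /\ forall y, K y -> H (y * x * y^-1)].

Lemma conjgvM (y a b : G) : y * (a * b) * y^-1 = (y * a * y^-1) * (y * b * y^-1).
Proof. by rewrite !mulgA mulgVK. Qed.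

Lemma conjgvV (y a : G) : y * a^-1 * y^-1 = (y * a * y^-1)^-1.
Proof. by rewrite !invgM invgK mulgA. Qed.

Lemma core_subgroup H K : subgroup H -> subgroup K -> subgroup (core H K).
Proof.
move=> [H1 HM HV] [K1 KM KV]; split.
- by split=> // y _; rewrite mulg1 mulgV.
- move=> a b [Ka ca] [Kb cb]; split; first exact: KM.
  by move=> y Ky; rewrite conjgvM; apply: HM; [exact: ca|exact: cb].
- move=> a [Ka ca]; split; first exact: KV.
  by move=> y Ky; rewrite conjgvV; apply: HV; exact: ca.
Qed.

Lemma core_sub H K : subgroup K -> core H K `<=` H.
Proof. by move=> [K1 _ _] x [_ /(_ _ K1)]; rewrite mul1g invg1 mulg1. Qed.

Lemma core_conj H K x y : subgroup K -> K y -> core H K x ->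
  core H K (y * x * y^-1).
Proof.
move=> sK Ky [Kx cx]; have [_ KM KV] := sK; split.
  by apply: subgroup_div => //; exact: KM.
by move=> z Kz; have := cx _ (KM _ _ Kz Ky); rewrite invgM !mulgA.
Qed.

(** The normalizer is stated with an equivalence because an inclusion of a
    conjugate of an infinite subgroup [N] in [N] need not be an equality. *)
Definition normalizer N : set G :=
  [set g | forall x, N x <-> N (g * x * g^-1)].

Lemma normalizer_subgroup N : subgroup (normalizer N).
Proof.
split.
- by move=> x; rewrite mul1g invg1 mulg1.
- move=> a b na nb x; rewrite nb na.
  by rewrite invgM !mulgA.
- move=> a na x; rewrite (na (a^-1 * x * _)).
  by rewrite invgK !mulgA mulgV mul1g mulgK.
Qed.

Lemma sub_normalizer_core H K : subgroup K -> K `<=` normalizer (core H K).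
Proof.
move=> sK y Ky x; split; first exact: core_conj.
have [_ _ KV] := sK => /(core_conj sK (KV _ Ky)).
by rewrite invgK !mulgA mulVg mul1g mulgVK.
Qed.

(** The graph of the permutation of the right cosets [H (t i)] induced by right
    multiplication by [x]; a boolean table, so that it lives in a finite type
    and makes sense before one knows that it is a permutation. *)
Definition coset_graph H n (t : 'I_n -> G) (x : G) : {ffun 'I_n * 'I_n -> bool} :=
  [ffun p => `[< H (t p.1 * x * (t p.2)^-1) >]].

Lemma coset_graphP H n (t : 'I_n -> G) x i j :
  coset_graph H t x (i, j) <-> H (t i * x * (t j)^-1).
Proof. by rewrite ffunE /=; split=> /asboolP. Qed.

Section CosetGraph.
Variables (H K : set G) (n : nat) (t : 'I_n -> G).
Hypotheses (sH : subgroup H) (sK : subgroup K) (tr : right_transversal H K t).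

Lemma coset_graph1 i j : coset_graph H t 1 (i, j) <-> i = j.
Proof.
have [H1 _ _] := sH; have [_ indt _] := tr.
rewrite coset_graphP mulg1; split; first exact: indt.
by move=> ->; rewrite mulgV.
Qed.

Lemma coset_graphM x y i j : K x ->
  coset_graph H t (x * y) (i, j) <->
  exists k, coset_graph H t x (i, k) /\ coset_graph H t y (k, j).
Proof.
move=> Kx; have [Kt _ covt] := tr; have [_ KM _] := sK.
have [_ HM HV] := sH.
rewrite coset_graphP; split => [ij|[k]]; last first.
  rewrite !coset_graphP => -[ik kj].
  by have := HM _ _ ik kj; rewrite !mulgA mulgVK.
have [k ik] := covt _ (KM _ _ (Kt i) Kx).
exists k; rewrite !coset_graphP; split=> //.
by have := HM _ _ (HV _ ik) ij; rewrite !invgM invgK !mulgA !mulgVK.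
Qed.

Lemma coset_graphV x i j :
  coset_graph H t x^-1 (i, j) <-> coset_graph H t x (j, i).
Proof.
have [_ _ HV] := sH.
by rewrite !coset_graphP; split=> /HV; rewrite !invgM !invgK !mulgA.
Qed.

(** The core is the kernel of the permutation action on the cosets. *)
Lemma core_coset_graph x : K x ->
  core H K x <-> forall i, coset_graph H t x (i, i).
Proof.
move=> Kx; have [Kt _ covt] := tr; have [_ HM _] := sH.
split=> [[_ cx] i|gx]; first by rewrite coset_graphP; exact: cx.
split=> // y Ky; have [i yi] := covt _ Ky.
have /coset_graphP xi := gx i.
have := subgroup_div sH (HM _ _ yi xi) yi.
by rewrite !invgM invgK !mulgA !mulgVK.
Qed.

(** Two elements that permute the cosets in the same way differ by an element of
    the kernel. *)
Lemma index_le_core : H `<=` K ->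
  index_le (core H K) H #|{: {ffun 'I_n * 'I_n -> bool}}|.
Proof.
move=> HK; have [Kt _ covt] := tr; have [_ KM _] := sK.
apply: (@index_le_fiber _ _ _ (coset_graph H t)) => // x y Hx Hy xy.
have [Kx Ky] := (HK _ Hx, HK _ Hy).
apply/core_coset_graph; first exact: subgroup_div.
move=> i; have [j ij] := covt _ (KM _ _ (Kt i) Kx).
rewrite coset_graphM//; exists j; rewrite coset_graphV -xy.
by split; apply/coset_graphP.
Qed.

End CosetGraph.

(** The permutation action is a morphism, so it is determined by its values on
    generators, even though [t] and [t'] are transversals in different groups. *)
Lemma eq_coset_graph_generated H K K' n (t t' : 'I_n -> G) S :
    subgroup H -> subgroup K -> subgroup K' ->
    right_transversal H K t -> right_transversal H K' t' ->
    S `<=` K -> S `<=` K' ->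
    (forall x, S x -> coset_graph H t x = coset_graph H t' x) ->
  forall x, generated S x -> coset_graph H t x = coset_graph H t' x.
Proof.
move=> sH sK sK' tr tr' SK SK' eqS.
pose A := [set x | [/\ K x, K' x & coset_graph H t x = coset_graph H t' x]].
have eqg x : (forall i j, coset_graph H t x (i, j) <-> coset_graph H t' x (i, j)) ->
    coset_graph H t x = coset_graph H t' x.
  by move=> eqx; apply/ffunP => -[i j]; apply/idP/idP => /eqx.
suff sA : subgroup A.
  move=> x /(generated_sub sA) []// y Sy; split; [exact: SK|exact: SK'|exact: eqS].
have [K1 KM KV] := sK; have [K'1 K'M K'V] := sK'.
split.
- split=> //; apply: eqg => i j.
  by rewrite (coset_graph1 sH tr) (coset_graph1 sH tr').
- move=> x y [Kx K'x ex] [Ky K'y ey]; split; [exact: KM|exact: K'M|].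
  apply: eqg => i j.
  by rewrite (coset_graphM sH sK tr)// (coset_graphM sH sK' tr')// ex ey.
- move=> x [Kx K'x ex]; split; [exact: KV|exact: K'V|].
  by apply: eqg => i j; rewrite !coset_graphV// ex.
Qed.

(** A finitely generated group has finitely many actions on ['I_n], hence
    finitely many kernels of such actions: the core is determined by the
    coset graphs of the generators. *)
Lemma eq_core H K K' n (t t' : 'I_n -> G) S :
    subgroup K -> subgroup K' -> H `<=` K -> H `<=` K' -> generated S = H ->
    right_transversal H K t -> right_transversal H K' t' ->
    (forall x, S x -> coset_graph H t x = coset_graph H t' x) ->
  core H K = core H K'.
Proof.
move=> sK sK' HK HK' genS tr tr' eqS.
have sH : subgroup H by rewrite -genS; exact: generated_subgroup.
have SH : S `<=` H by rewrite -genS; exact: sub_generated.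
have eqH x : H x -> coset_graph H t x = coset_graph H t' x.
  rewrite -{1}genS; apply: (eq_coset_graph_generated sH sK sK' tr tr') => //.
    exact: subset_trans HK.
  exact: subset_trans HK'.
apply/seteqP; split=> x cx.
  have Hx := core_sub sK cx.
  apply/(core_coset_graph sH tr' (HK' _ Hx)); rewrite -eqH//.
  exact/(core_coset_graph sH tr (HK _ Hx)).
have Hx := core_sub sK' cx.
apply/(core_coset_graph sH tr (HK _ Hx)); rewrite eqH//.
exact/(core_coset_graph sH tr' (HK' _ Hx)).
Qed.

(** An intermediate subgroup is a union of cosets of [N]. *)
Lemma finite_intermediate_subgroups N L m : subgroup N -> index_le N L m ->
  finite_set [set K | [/\ subgroup K, N `<=` K & K `<=` L]].
Proof.
move=> sN /(exists_right_transversal sN)[n [t [_ [Lt indt covt]]]].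
pose join (a : {ffun 'I_n -> bool}) := [set x | exists i, a i /\ N (x * (t i)^-1)].
apply: (@sub_finite_set _ _ (range join)); last exact/finite_image/finite_finset.
move=> K [sK NK KL]; exists [ffun i => `[< K (t i) >]] => //.
have [_ KM _] := sK; apply/seteqP; split=> x.
  move=> [i []]; rewrite ffunE => /asboolP Ki /NK xi.
  by have := KM _ _ xi Ki; rewrite mulgVK.
move=> Kx; have [i xi] := covt _ (KL _ Kx); exists i; split=> //.
rewrite ffunE; apply/asboolP.
have := KM _ _ (NK _ (subgroup_divC sN xi)) Kx; by rewrite mulgVK.
Qed.

(** * Continuity of translations *)

Lemma divg_continuous : continuous (fun z : G * G => z.1 * z.2^-1).
Proof.
move=> z; apply: (@cvg_comp _ _ _ (fun z : G * G => (z.1, z.2^-1))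
  (fun z : G * G => z.1 * z.2)); last exact: (@mulg_continuous G (z.1, z.2^-1)).
have h2 : (x.2)^-1 @[x --> z] --> (z.2)^-1.
  apply: (@cvg_comp _ _ _ (fun z : G * G => z.2) (fun x : G => x^-1)); last exact: invg_continuous.
  exact: cvg_snd.
have h1 : x.1 @[x --> z] --> z.1 by exact: cvg_fst.
exact: (cvg_pair h1 h2).
Qed.

Lemma continuous_mulgl (g : G) : continuous (fun x : G => g * x).
Proof.
move=> x; apply: (@cvg_comp _ _ _ (fun y => (g, y)) (fun z : G * G => z.1 * z.2)).
  exact: (cvg_pair (cvg_cst g) cvg_id).
exact: (@mulg_continuous G (g, x)).
Qed.

Lemma continuous_mulgr (g : G) : continuous (fun x : G => x * g).
Proof.
move=> x; apply: (@cvg_comp _ _ _ (fun y => (y, g)) (fun z : G * G => z.1 * z.2)).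
  exact: (cvg_pair cvg_id (cvg_cst g)).
exact: (@mulg_continuous G (x, g)).
Qed.

(** * Haar measure and covolume *)

Definition translate (g : G) (A : set G) : set G := [set g * x | x in A].

Lemma translateP g (A : set G) x : translate g A x <-> A (g^-1 * x).
Proof.
split=> [[y Ay <-]|Ax]; first by rewrite mulKg.
by exists (g^-1 * x) => //; rewrite mulVKg.
Qed.

Lemma translate_preimage g (A : set G) : translate g A = (fun x => g^-1 * x) @^-1` A.
Proof. by apply/seteqP; split=> x /translateP. Qed.

Lemma open_translate g (A : set G) : open A -> open (translate g A).
Proof.
by move=> oA; rewrite translate_preimage; apply: open_comp => // x _; exact: continuous_mulgl.
Qed.

Lemma measurable_translate g (A : set borel) :
  measurable A -> measurable (translate g A : set borel).
Proof.
move=> mA; rewrite translate_preimage -[X in measurable X]setTI.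
apply: (@measurability _ _ borel borel setT _ (@open G)) mA => //.
move=> _ [B oB <-]; rewrite setTI; apply: sub_sigma_algebra.
by apply: open_comp => // x _; exact: continuous_mulgl.
Qed.

Lemma measurable_open (A : set G) : open A -> measurable (A : set borel).
Proof. exact: sub_sigma_algebra. Qed.

Section Haar.
Variables (R : realType) (mu : {measure set borel -> \bar R}).
Hypothesis hausG : hausdorff_space G.
Hypothesis haar : is_haar_measure mu.

Lemma haar_translate g (A : set borel) : measurable A -> mu (translate g A) = mu A.
Proof. by case: haar => _ _ + _ _; apply. Qed.

(** If [W] were null, every compact set, being covered by finitely many
    translates of [W], would be null, and so would the whole group by inner
    regularity. *)
Lemma haar_open_gt0 W : open W -> W 1 -> (0 < mu W)%E.
Proof.
move=> oW W1; rewrite lt0e measure_ge0 andbT; apply/eqP => W0.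
have [/eqP muG _ _ _ inner] := haar.
apply: muG; rewrite (inner _ openT).
apply/eqP; rewrite eq_le; apply/andP; split; last first.
  by apply: ereal_sup_ubound; exists set0 => //; split=> //; exact: compact0.
apply: ge_ereal_sup => _ [K [cK _] <-].
have := cK; rewrite compact_cover => /(_ G setT (translate ^~ W)).
case=> [g _|x _|fs _ Kcov]; first exact: open_translate.
  by exists x => //; apply/translateP; rewrite mulVg.
have mW g : measurable (translate g W : set borel).
  by apply: measurable_translate; exact: measurable_open.
have null : mu.-negligible (\big[setU/set0]_(g <- fs) (translate g W : set borel)).
  elim/big_ind: _ => [|A B nA nB|g _].
  - exact: negligible_set0.
  - exact: negligibleU.
  - by exists (translate g W); split=> //; rewrite haar_translate//; exact: measurable_open.
have mK : measurable (K : set borel).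
  rewrite -[K]setCK; apply: measurableC; apply: measurable_open.
  by apply: closed_openC; exact: compact_closed.
have [B [mB B0 KB]] := null.
rewrite -B0; apply: le_measure; rewrite ?inE//.
by move=> x Kx; apply: KB; rewrite -bigcup_fset; have [g] := Kcov _ Kx; exists g.
Qed.

(** A set [A] that embeds in the quotient by [H] has at most the measure of the
    quotient: the intersections of [A] with the [h D], translated back by [h^-1],
    are disjoint subsets of [D].  Countability of [H] makes this a countable sum. *)
Lemma haar_le_fundamental_domain H (A D : set borel) :
    subgroup H -> countable H -> is_fundamental_domain H D -> measurable A ->
    (forall h x, H h -> A x -> A (h * x) -> h = 1) ->
  (mu A <= mu D)%E.
Proof.
move=> sH /countable_injP[f injf] [mD domD] mA disjA.
(* the elements of [H] are indexed by a set [I] of integers, with inverse [e] *)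
pose I := f @` H; pose e n := xget 1 [set h | H h /\ f h = n].
have eP n : I n -> H (e n) /\ f (e n) = n.
  by move=> [h Hh fh]; apply: (xgetPex 1 (P := [set h | H h /\ f h = n])); exists h.
have eK h : H h -> e (f h) = h.
  move=> Hh; have [|He fe] := eP (f h); first by exists h.
  by apply: injf => //; rewrite inE.
pose P n : set borel := A `&` translate (e n) D.
pose Q n : set borel := translate (e n)^-1 A `&` D.
have mP n : measurable (P n) by apply: measurableI => //; exact: measurable_translate.
have mQ n : measurable (Q n) by apply: measurableI => //; exact: measurable_translate.
have PQ n : mu (P n) = mu (Q n).
  rewrite -(haar_translate (e n)^-1)//; congr (mu _).
  apply/seteqP; split=> x.
    move=> /translateP [Ax /translateP]; rewrite invgK mulKg => Dx; split=> //.
    by apply/translateP; rewrite invgK in Ax *.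
  move=> [/translateP Ax Dx]; apply/translateP; split => //.
  by apply/translateP; rewrite invgK mulKg.
have AE : A = \bigcup_(n in I) P n.
  apply/seteqP; split=> [x Ax|x [n _ []]//].
  have [y [[Dy [h Hh yE]] _]] := domD x.
  have Hh' : H h^-1 by case: sH => _ _; apply.
  exists (f h^-1); first by exists h^-1.
  by split=> //; apply/translateP; rewrite eK// invgK -yE.
have tP : trivIset I P.
  move=> i j /eP[Hi fi] /eP[Hj fj] [x [[_ /translateP Di] [_ /translateP Dj]]].
  rewrite -fi -fj; congr f; apply: invg_inj; apply: (mulIg x).
  have [_ _ HV] := sH; have [y [_ uy]] := domD x.
  have ui := uy _ (conj Di (ex_intro2 _ _ _ (HV _ Hi) erefl)).
  by have uj := uy _ (conj Dj (ex_intro2 _ _ _ (HV _ Hj) erefl)); rewrite -ui -uj.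
have tQ : trivIset I Q.
  move=> i j /eP[Hi fi] /eP[Hj fj] [x [[/translateP + _] [/translateP + _]]].
  rewrite !invgK => Ai Aj; rewrite -fi -fj; congr f; symmetry; apply: divg1_eq.
  apply: (disjA _ (e i * x)) => //; first exact: subgroup_div.
  by rewrite mulgA mulgVK.
rewrite AE measure_bigcup//; under eq_eseriesr do rewrite PQ.
rewrite -measure_bigcup//; apply: le_measure; rewrite ?inE//.
  by apply: bigcup_measurable.
by move=> x [n _ []].
Qed.

(** The lower bound on covolumes behind the whole argument.  If the conjugate of
    [K] by [g] meets [U] trivially and [W] is so small that [W W^-1] lies in [U],
    then the left translates of [g^-1 W] by [K] are pairwise disjoint.  So, if the
    [t i] are inequivalent modulo [H], the union of the [t i g^-1 W] embeds in the
    quotient by [H], and the number of the [t i] is at most [mu D / mu W].  This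
    bound depends neither on [K] nor on [g], because [g] only enters through left
    translates of [W]. *)
Lemma index_le_covolume H (D : set borel) U :
    subgroup H -> countable H -> is_fundamental_domain H D -> (mu D < +oo)%E ->
    nbhs (1 : G) U ->
  exists m, forall K g, subgroup K -> H `<=` K ->
    conjugate g K `&` U `<=` [set 1] -> index_le H K m.
Proof.
move=> sH cH domD Doo nU.
have [W [oW W1 WU]] : exists W : set G, [/\ open W, W 1 &
    forall x y, W x -> W y -> U (x * y^-1)].
  have : (fun z : G * G => z.1 * z.2^-1) z @[z --> ((1 : G), (1 : G))] --> (1 : G).
    by rewrite -[X in _ --> X](mulgV 1); exact: (@divg_continuous (1, 1)).
  move=> /(_ U nU) [[A B] [/= nA nB] AB].
  exists (interior (A `&` B)); split; first exact: open_interior.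
    exact: filterI.
  by move=> x y /interior_subset[Ax _] /interior_subset[_ By]; apply: (AB (x, y)).
have mW := measurable_open oW.
have W0 := haar_open_gt0 oW W1.
exists (Num.truncn (fine (mu D) / fine (mu W))%R) => K g sK HK KU n t Kt indt.
have [H1 HM HV] := sH; have [K1 KM KV] := sK.
have disj x w w' : K x -> W w -> W w' -> x * (g^-1 * w) = g^-1 * w' -> x = 1.
  move=> Kx Ww Ww' xw; suff gx : g * x * g^-1 = 1.
    by rewrite -(mulKg g x) (divg1_eq gx) mulVg.
  apply: KU; split; first by exists x.
  have -> : g * x * g^-1 = w' * w^-1.
    by apply: (mulIg w); rewrite mulgVK -!mulgA xw mulVKg.
  exact: WU.
pose T i : set borel := translate (t i * g^-1) W.
have mT i : measurable (T i) by exact: measurable_translate.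
have overlap h i j x : H h -> T i x -> T j (h * x) -> h = t j * (t i)^-1.
  move=> Hh /translateP xi /translateP xj.
  have eq1 : (t j)^-1 * h * t i = 1.
    apply: (disj _ _ _ _ xi xj).
      by apply: (KM) => //; apply: (KM); [exact: KV|exact: HK].
    by rewrite !invgM !invgK !mulgA mulgVK mulgK mulVg mul1g.
  apply: (mulgI (t j)^-1); apply: (mulIg (t i)).
  by rewrite eq1 mulKg mulVg.
have tT : trivIset setT T.
  move=> i j _ _ [x [xi xj]]; apply/esym/indt.
  by rewrite -(overlap 1 i j x)// mul1g.
have nD : (mu (\big[setU/set0]_(i < n) T i) <= mu D)%E.
  apply: (haar_le_fundamental_domain sH cH domD).
    exact: bigsetU_measurable.
  move=> h x Hh; rewrite -!bigcup_seq => -[i _ xi] [j _ xj].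
  have hE := overlap _ _ _ _ Hh xi xj.
  by rewrite hE (indt j i) ?mulgV// -hE.
rewrite measure_bigsetU_ord// in nD.
have muT i : mu (T i) = mu W by rewrite haar_translate.
rewrite (eq_bigr (fun=> mu W)) in nD => [|i _]; last exact: muT.
(* if there is at least one [t i], then [mu W <= mu D], so [mu W] is finite and
   the division makes sense *)
case: n t Kt indt T mT overlap tT nD muT => // n t _ _ T _ _ _ nD _.
have WD : (mu W <= mu D)%E.
  by apply: le_trans nD; rewrite big_ord_recl leeDl// sume_ge0.
have Wfin : mu W \is a fin_num by rewrite ge0_fin_numE//; exact: le_lt_trans Doo.
have Dfin : mu D \is a fin_num by rewrite ge0_fin_numE.
move: nD W0; rewrite -(fineK Wfin) -(fineK Dfin) sumEFin lee_fin lte_fin.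
rewrite sumr_const card_ord /= => nD W0.
rewrite truncn_ge_nat; last by rewrite divr_ge0// fine_ge0.
by rewrite ler_pdivlMr// mulr_natl.
Qed.

(** The union of the translates of [D] by representatives of the cosets of [N]. *)
Lemma fundamental_domain_finite_index H N (D : set borel) n (t : 'I_n -> G) :
    subgroup H -> subgroup N -> N `<=` H -> right_transversal N H t ->
    is_fundamental_domain H D -> (mu D < +oo)%E ->
  exists2 D' : set borel, is_fundamental_domain N D' & (mu D' < +oo)%E.
Proof.
move=> sH sN NH [Ht indt covt] [mD domD] Doo.
have [_ HM HV] := sH; have [_ NM NV] := sN.
have mT i : measurable (translate (t i) D : set borel) by exact: measurable_translate.
exists (\big[setU/set0]_(i < n) (translate (t i) D : set borel)); last first.
  suff [] : measurable (\big[setU/set0]_(i < n) (translate (t i) D : set borel)) /\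
    (mu (\big[setU/set0]_(i < n) (translate (t i) D : set borel)) < +oo)%E by [].
  elim/big_ind: _ => [|A B [mA Aoo] [mB Boo]|i _].
  - by rewrite measure0.
  - split; first exact: measurableU.
    by apply: (le_lt_trans (measureU2 _ _ _)) => //; exact: lte_add_pinfty.
  - by rewrite haar_translate.
split=> [|x]; first exact: bigsetU_measurable.
rewrite -bigcup_seq; have [d [[Dd [h Hh dE]] ud]] := domD x.
have [i hi] := covt _ (HV _ Hh).
have Nh : N (t i * h) by have := NV _ hi; rewrite !invgM !invgK.
exists (t i * d); split.
  split; last by exists (t i * h) => //; rewrite dE mulgA.
  exists i; first by rewrite /= mem_index_enum.
  by exists d.
move=> _ [[j _ [d' Dd' <-]] [m Nm yE]].
have d'E : d' = (t j)^-1 * m * x by rewrite -mulgA -yE mulKg.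
have dd' : d = d'.
  apply: ud; split=> //; exists ((t j)^-1 * m) => //.
  by apply: (HM); [exact: HV|exact: NH].
have hE : h = (t j)^-1 * m by apply: (mulIg x); rewrite -dE -d'E.
rewrite dd'; congr (t _ * _); apply: indt; rewrite hE mulgA in Nh.
by have := NM _ _ Nh (NV _ Nm); rewrite mulgK.
Qed.

End Haar.

(** * Lattices and their normalizers *)

Lemma discrete_sub N H : subgroup N -> N `<=` H -> discrete_subgroup H -> discrete_subgroup N.
Proof.
move=> sN NH [_ isoH]; split=> // x Nx.
have [_ [V nV VH]] := isoH _ (NH _ Nx); split; first exact: mem_set.
exists V => //; apply/seteqP; split=> [y [Vy /NH Hy]|y ->].
  by rewrite -VH.
split=> //; exact: nbhs_singleton.
Qed.

Lemma nbhs_commutator (s : G) V : nbhs (1 : G) V ->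
  nbhs (1 : G) [set x | V (x * s / (s * x))].
Proof.
move=> nV; have : (x * s) / (s * x) @[x --> (1 : G)] --> (1 : G).
  have e1 : (1 * s) / (s * 1) = 1 by rewrite mul1g mulg1 mulgV.
  rewrite -[X in _ --> X]e1.
  apply: (@cvg_comp _ _ _ (fun x => (x * s, s * x)) (fun z : G * G => z.1 / z.2)); last first.
    exact: (@divg_continuous (1 * s, s * 1)).
  have sr : x * s @[x --> (1 : G)] --> 1 * s by exact: continuous_mulgr.
  have sl : s * x @[x --> (1 : G)] --> s * 1 by exact: continuous_mulgl.
  exact: (cvg_pair sr sl).
exact.
Qed.

(** For [x] normalizing [N] and close to 1, the commutators of [x] with the
    finitely many generators of [N] lie in [N] and are close to 1, hence trivial;
    so [x] centralizes [N]. *)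
Lemma normalizer_discrete N :
    discrete_subgroup N -> finitely_generated N -> centralizer N = [set 1] ->
  exists2 U, nbhs (1 : G) U & normalizer N `&` U `<=` [set 1].
Proof.
move=> [sN isoN] [S finS genS] cN; have [N1 NM NV] := sN.
have [_ [V nV VN]] := isoN _ N1.
have SN : S `<=` N by rewrite -genS; exact: sub_generated.
exists (\bigcap_(s in S) [set x | V (x * s / (s * x))]).
  have [X ->] := finite_fsetP.1 finS.
  by apply: filter_bigI => s _; apply: nbhs_commutator.
move=> x [nx Vx]; rewrite -cN /=.
pose C := [set y | x * y = y * x].
have sC : subgroup C.
  split=> [|y z xy xz|y xy]; rewrite /C /=.
  - by rewrite mulg1 mul1g.
  - by rewrite mulgA xy -mulgA xz mulgA.
  - by apply: (mulgI y); rewrite mulVKg mulgA -xy mulgK.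
have SC : S `<=` C.
  move=> s Ss; have Ns := SN _ Ss.
  have : [set 1] (x * s / (s * x)).
    rewrite -VN; split; first exact: Vx.
    by rewrite invgM mulgA; apply: subgroup_div => //; exact: (nx s).1.
  by move=> /divg1_eq.
by rewrite -genS; apply: generated_sub.
Qed.

Section Lattices.
Variable R : realType.

Lemma lattice_subgroup H : lattice R H -> subgroup H.
Proof. by case=> [[]]. Qed.

Lemma lattice_finite_index H N n (t : 'I_n -> G) :
    subgroup N -> N `<=` H -> right_transversal N H t -> lattice R H ->
  lattice R N.
Proof.
move=> sN NH tr latH; have sH := lattice_subgroup latH.
have [disH [mu [D [haar domD Doo]]]] := latH.
split; first exact: discrete_sub disH.
have [D' domD' D'oo] := fundamental_domain_finite_index haar sH sN NH tr domD Doo.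
by exists mu, D'.
Qed.

(** The normalizer of [N] is discrete, so the covolume bound, applied to it with
    the trivial conjugation, shows that it contains [N] with finite index. *)
Lemma finite_subgroups_normalizing N : hausdorff_space G ->
    lattice R N -> finitely_generated N -> centralizer N = [set 1] ->
  finite_set [set K | [/\ subgroup K, N `<=` K & K `<=` normalizer N]].
Proof.
move=> hausG latN fgN cN; have sN := lattice_subgroup latN.
have [disN [mu [D [haar domD Doo]]]] := latN.
have [U nU LU] := normalizer_discrete disN fgN cN.
have cntN := finitely_generated_countable fgN.
have [m idx] := index_le_covolume hausG haar sN cntN domD Doo nU.
apply: (@finite_intermediate_subgroups N _ m) => //.
apply: (idx _ 1) => //; first exact: normalizer_subgroup.
- move=> x Nx y; have [_ NM NV] := sN; split=> [Ny|].
    by apply: subgroup_div => //; exact: NM.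
  by move=> /(NM _ _ (NV _ Nx)) /NM /(_ Nx); rewrite !mulgA mulVg mul1g mulgVK.
- move=> x [[y Ly <-] Ux]; apply: LU; split=> //.
  by rewrite mul1g invg1 mulg1.
Qed.

(** The subgroups [K] over [H] with [n] cosets on which the generators [s] of [H]
    act by the prescribed tables [c] all have the same core, hence lie between
    this core and its normalizer. *)
Lemma finite_supergroups_coset_graph H s n
    (c : {ffun 'I_(size s) -> {ffun 'I_n * 'I_n -> bool}}) :
    hausdorff_space G ->
    (forall N, lattice R N -> centralizer N = [set 1]) ->
    lattice R H -> generated [set` s] = H ->
  finite_set [set K | [/\ subgroup K, H `<=` K & exists t : 'I_n -> G,
    right_transversal H K t /\ forall i : 'I_(size s), coset_graph H t (nth 1 s i) = c i]].
Proof.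
move=> hausG centG latH genH; have sH := lattice_subgroup latH.
set P := [set K | _].
have [->|/set0P[K0 [sK0 HK0 [t0 [tr0 c0]]]]] := eqVneq P set0.
  exact: finite_set0.
pose N := core H K0.
have sN : subgroup N by exact: core_subgroup.
have NH : N `<=` H by exact: core_sub.
have [q [u [_ tru]]] := exists_right_transversal sN (index_le_core sH sK0 tr0 HK0).
have fgH : finitely_generated H by exists [set` s] => //; exact: finite_seq.
have fgN : finitely_generated N by exact: finitely_generated_transversal tru.
have latN : lattice R N by exact: lattice_finite_index tru latH.
have fin := finite_subgroups_normalizing hausG latN fgN (centG _ latN).
apply: sub_finite_set fin => K [sK HK [t [tr ct]]].
have -> : N = core H K.
  apply: (eq_core sK0 sK HK0 HK genH tr0 tr) => x xs.
  have xi : (index x s < size s)%N by rewrite index_mem.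
  by have := c0 (Ordinal xi); rewrite -ct /= nth_index.
split=> //; last exact: sub_normalizer_core.
by apply: subset_trans HK; exact: core_sub.
Qed.

End Lattices.
End Lattices_in_topological_groups.

Theorem theorem1p8 (R : realType) (G : topologicalGroupType)
    (lcG : locally_compact_group G)
    (cgG : compactly_generated G)
    (centG : forall H : set G, lattice R H -> centralizer H = [set 1])
    (F : set (set G))
    (latF : forall H, F H -> lattice R H)
    (kmF : propertyKM F)
    (leastF : exists H, finitely_generated H /\ least_element F H) :
  finite_set F.
Proof.
have [hausG _] := lcG; have [U nU kmU] := kmF.
have [H [fgH [FH leastH]]] := leastF.
have latH := latF _ FH; have sH := lattice_subgroup latH.
have [_ [mu [D [haar domD Doo]]]] := latH.
have cH := finitely_generated_countable fgH.
have [m idx] := index_le_covolume hausG haar sH cH domD Doo nU.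
have [S /finite_seqP[s ->] genH] := fgH.
pose P (n : 'I_m.+1) (c : {ffun 'I_(size s) -> {ffun 'I_n * 'I_n -> bool}}) :=
  [set K | [/\ subgroup K, H `<=` K & exists t : 'I_n -> G,
    right_transversal H K t /\ forall i : 'I_(size s), coset_graph H t (nth 1 s i) = c i]].
apply: (@sub_finite_set _ _ (\bigcup_n \bigcup_c P n c)); last first.
  apply: bigcup_finite => [|n _]; first exact: finite_finset.
  apply: bigcup_finite => [|c _]; first exact: finite_finset.
  exact: finite_supergroups_coset_graph hausG centG latH genH.
move=> K FK; have sK := lattice_subgroup (latF _ FK); have HK := leastH _ FK.
have [g gK] := kmU _ FK.
have idxK : index_le H K m by apply: (idx K g) => //; rewrite gK.
have [n [t [nm tr]]] := exists_right_transversal sH idxK.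
exists (Ordinal (nm : (n < m.+1)%N)) => //.
exists [ffun i : 'I_(size s) => coset_graph H t (nth 1 s i)] => //.
by split=> //; exists t; split=> // i; rewrite ffunE.
Qed.
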